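(* Let $\alpha>0$, $A\ge0$, $B>0$, $t>0$, and let $P_n(x,t)=x^n+\mathsf{p}_1(n,t)x^{n-1}+\cdots$ be the monic polynomials orthogonal on $[0,\infty)$ w.r.t. $w(x,t)=x^\alpha e^{-x}(A+B\theta(x-t))$, with norms $h_n(t)$, recurrence $zP_n=P_{n+1}+\alpha_nP_n+\beta_nP_{n-1}$, $\beta_n=h_n/h_{n-1}$, and $\mathsf{p}_1(0,t)=0$. Let $R_n(t)=Bt^\alpha e^{-t}\{P_n(t,t)\}^2/h_n(t)$ and $r_n(t)=Bt^\alpha e^{-t}P_n(t,t)P_{n-1}(t,t)/h_{n-1}(t)$. Then for $n\ge1$ $$t\sum_{j=0}^{n-1}R_j=-t\,r_n-n(n+\alpha)+\beta_n,\qquad \sum_{j=0}^{n-1}\alpha_j=-\mathsf{p}_1(n,t)=\beta_n-t\,r_n.$$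
   Context: $\theta$ is the Heaviside function ($1$ for $x>0$, $0$ otherwise); $P_n(t,t)$ is $P_n(x,t)$ at $x=t$. *)

(* Defs.v *)
From HB Require Import structures.
From mathcomp Require Import all_boot all_order all_algebra.
From mathcomp Require Import all_classical all_reals all_analysis.
Set Implicit Arguments. Unset Strict Implicit. Unset Printing Implicit Defensive.
Import Order.TTheory GRing.Theory Num.Theory.
Local Open Scope ring_scope.
Local Open Scope classical_set_scope.

Section Defs.
Variable R : realType.

Definition heaviside (x : R) : R := if 0 < x then 1 else 0.

Definition weight (alpha A B t : R) (x : R) : R :=
  powR x alpha * expR (- x) * (A + B * heaviside (x - t)).

Definition monic_orthogonal (alpha A B t : R) (P : nat -> {poly R}) : Prop :=
  (forall n, P n \is monic) /\ (forall n, size (P n) = n.+1) /\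
  (forall m n, m <> n ->
     (\int[lebesgue_measure]_(x in `[0%R, +oo[)
        ((P m).[x] * (P n).[x] * weight alpha A B t x)%:E = 0)%E).

Definition hnorm (alpha A B t : R) (P : nat -> {poly R}) (n : nat) : R :=
  Rintegral lebesgue_measure `[0%R, +oo[
    (fun x => (P n).[x] ^+ 2 * weight alpha A B t x).

Definition beta_coef alpha A B t P (n : nat) : R :=
  hnorm alpha A B t P n / hnorm alpha A B t P n.-1.

(* alpha_n : coefficient of P_n in z P_n = P_{n+1} + alpha_n P_n + beta_n P_{n-1},
   i.e. alpha_n = (int x P_n^2 w) / h_n *)
Definition alpha_coef alpha A B t P (n : nat) : R :=
  Rintegral lebesgue_measure `[0%R, +oo[
    (fun x => x * (P n).[x] ^+ 2 * weight alpha A B t x) / hnorm alpha A B t P n.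

Definition p1 (P : nat -> {poly R}) (n : nat) : R :=
  if n is n'.+1 then (P n)`_n' else 0.

Definition Rn alpha A B t P (n : nat) : R :=
  B * powR t alpha * expR (- t) * (P n).[t] ^+ 2 / hnorm alpha A B t P n.

Definition rn alpha A B t P (n : nat) : R :=
  B * powR t alpha * expR (- t) * (P n).[t] * (P n.-1).[t]
    / hnorm alpha A B t P n.-1.
End Defs.

(* Main.v *)
(* Let L be integration against the weight w. Integrating the derivative of
   x q(x) x^alpha e^(-x) over [0, +oo[ and over [t, +oo[ gives, for every
   polynomial q,
     L ((1 + alpha - x) q + x q') = - t B t^alpha e^(-t) q(t).
   With q = P_n^2 this reads alpha_n = 2n + 1 + alpha + t R_n, and with
   q = P_n P_(n-1) it reads - p1(n) = beta_n - t r_n, because orthogonality lets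
   one compute L (P_m p) from the two top coefficients of p. Comparing
   coefficients in the recurrence gives alpha_n = p1(n) - p1(n+1), and the sums
   over j telescope. *)
Require Import Defs.
From HB Require Import structures.
From mathcomp Require Import all_boot all_order all_algebra.
From mathcomp Require Import all_classical all_reals all_analysis.
From mathcomp Require Import measurable_realfun ring.
Import Order.TTheory GRing.Theory Num.Theory.
Local Open Scope ring_scope.

Lemma coef_derivX (R : nzRingType) (p : {poly R}) (i : nat) :
  ('X * p^`())`_i = p`_i *+ i.
Proof. by rewrite coefXM; case: i => [|i] /=; rewrite ?mulr0n ?coef_deriv. Qed.

Lemma monic_coef (R : nzSemiRingType) (p : {poly R}) (n : nat) :
  p \is monic -> size p = n.+1 -> p`_n = 1.
Proof. by move=> /monicP <- sp; rewrite lead_coefE sp. Qed.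

(** * Monic orthogonal polynomials for a linear functional *)

Section OrthogonalPolynomials.
Context {F : fieldType}.
Variables (L : {scalar {poly F}}) (P : nat -> {poly F}).
Hypothesis P_monic : forall n, P n \is monic.
Hypothesis size_P : forall n, size (P n) = n.+1.
Hypothesis P_orth : forall m n, m <> n -> L (P m * P n) = 0.

Let coefPn n : (P n)`_n = 1.
Proof. exact: monic_coef (P_monic n) (size_P n). Qed.

Let size_subZP n (q : {poly F}) : (size q <= n.+1)%N ->
  (size (q - q`_n *: P n)%R <= n)%N.
Proof.
move=> sq; apply/leq_sizeP => j nj; rewrite coefB coefZ.
have [->|jn] := eqVneq j n; first by rewrite coefPn mulr1 subrr.
have ltnj : (n < j)%N by rewrite ltn_neqAle eq_sym jn.
have -> : q`_j = 0 by rewrite nth_default// (leq_trans sq).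
by rewrite [(P n)`_j]nth_default ?size_P// mulr0 subr0.
Qed.

(** Removing the top coefficient with a multiple of a monic [P k], again and again, expands [q] in
    the [P k] with [k < n], all orthogonal to [P n]. *)
Lemma orth_low n (q : {poly F}) : (size q <= n)%N -> L (P n * q) = 0.
Proof.
(* The index of [P n] stays fixed; the induction is on the size bound [k] of the other factor. *)
suff low k : (k <= n)%N -> forall r : {poly F}, (size r <= k)%N -> L (P n * r) = 0.
  exact: low.
elim: k => [_|k IH kn] r sr.
  by move: sr; rewrite leqn0 size_poly_eq0 => /eqP->; rewrite mulr0 linear0.
rewrite -(subrK (r`_k *: P k) r) mulrDr linearD.
rewrite IH ?size_subZP// ?(ltnW kn)// add0r -scalerAr scalarZ P_orth ?mulr0//.
by move=> nk; rewrite nk ltnn in kn.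
Qed.

Lemma orth_top n (q : {poly F}) : (size q <= n.+1)%N ->
  L (P n * q) = q`_n * L (P n ^+ 2).
Proof.
move=> sq; rewrite -{1}(subrK (q`_n *: P n) q) mulrDr linearD.
by rewrite orth_low ?size_subZP// add0r -scalerAr scalarZ expr2.
Qed.

Lemma orth_next n (q : {poly F}) : (size q <= n.+2)%N ->
  L (P n * q) = (q`_n - q`_n.+1 * (P n.+1)`_n) * L (P n ^+ 2).
Proof.
move=> sq; have nSn : n <> n.+1 by move/eqP; rewrite ltn_eqF.
rewrite -{1}(subrK (q`_n.+1 *: P n.+1) q) mulrDr linearD.
rewrite orth_top ?size_subZP// -scalerAr scalarZ (P_orth _ _ nSn) mulr0 addr0.
by rewrite coefB coefZ.
Qed.

End OrthogonalPolynomials.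

(* Below [L] is integration against [x^a e^(-x) (A + B theta (x - t))] and
   [c] is [B t^a e^(-t)]; [pearson] is integration by parts for [x q(x)]. *)
Section LaguerreJump.
Context {R : realType}.
Variables (L : {scalar {poly R}}) (P : nat -> {poly R}) (a c t : R).
Hypothesis P_monic : forall n, P n \is monic.
Hypothesis size_P : forall n, size (P n) = n.+1.
Hypothesis P_orth : forall m n, m <> n -> L (P m * P n) = 0.
Hypothesis pearson : forall q,
  L (((1 + a)%:P - 'X) * q + 'X * q^`()) = - (t * c * q.[t]).

Let h n := L (P n ^+ 2).

Let coefPn n : (P n)`_n = 1.
Proof. exact: monic_coef (P_monic n) (size_P n). Qed.

Let size_XP n : size ('X * P n) = n.+2.
Proof. by rewrite mulrC size_mulX ?size_P// -size_poly_eq0 size_P. Qed.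

Let size_XdP n : (size ('X * (P n)^`())%R <= n.+1)%N.
Proof.
by apply/leq_sizeP => j nj; rewrite coef_derivX nth_default ?mul0rn ?size_P.
Qed.

(** The two top coefficients of ['X * P n] are [1] and [p1 P n], to which [orth_next] applies. *)
Lemma moment_X n : L ('X * P n ^+ 2) = (p1 P n - p1 P n.+1) * h n.
Proof.
rewrite expr2 mulrCA (orth_next _ _ P_monic size_P P_orth) ?size_XP//.
(* For [n = 0] the constant coefficient of ['X * P 0] is [0], in agreement with [p1 P 0 = 0]. *)
by rewrite !coefXM coefPn mul1r; case: n.
Qed.

Lemma pearson_diag n :
  (p1 P n - p1 P n.+1) * h n =
    (1 + a + n%:R *+ 2) * h n + t * c * (P n).[t] ^+ 2.
Proof.
have := pearson (P n ^+ 2).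
rewrite mulrBl mul_polyC linearD linearB scalarZ/= moment_X -/(h n).
rewrite (_ : 'X * (P n ^+ 2)^`() = P n * ('X * (P n)^`()) *+ 2); last first.
  by rewrite deriv_exp/= expr1; ring.
rewrite linearMn (orth_top _ _ P_monic size_P P_orth) ?size_XdP//.
rewrite coef_derivX coefPn -/(h n) horner_exp => E.
by rewrite -[t * c * _]opprK -E /=; ring.
Qed.

Lemma pearson_offdiag n :
  - p1 P n.+1 * h n = h n.+1 - t * c * (P n.+1).[t] * (P n).[t].
Proof.
have := pearson (P n.+1 * P n).
rewrite mulrBl mul_polyC linearD linearB scalarZ/= P_orth; last first.
  by move/eqP; rewrite gtn_eqF.
rewrite mulr0 sub0r derivM mulrDr linearD/= hornerM.
rewrite (_ : 'X * (P n.+1 * P n) = P n.+1 * ('X * P n)); last by ring.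
rewrite (orth_top _ _ P_monic size_P P_orth) ?size_XP//.
rewrite coefXM coefPn mul1r -/(h n.+1).
rewrite (_ : 'X * ((P n.+1)^`() * P n) = P n * ('X * (P n.+1)^`())); last by ring.
rewrite (_ : 'X * (P n.+1 * (P n)^`()) = P n.+1 * ('X * (P n)^`())); last by ring.
rewrite (orth_next _ _ P_monic size_P P_orth) ?size_XdP//.
rewrite (orth_low _ _ P_monic size_P P_orth n.+1) ?size_XdP//.
rewrite !coef_derivX coefPn -/(h n) /= addr0 mulrS -!mulrA => E.
by rewrite -[- (t * _)]E /=; ring.
Qed.

End LaguerreJump.

(** * The kernel [x^s e^(-x)], its polynomial moments, and the weight with a jump *)

Section Analysis.
Import numFieldNormedType.Exports.
Local Open Scope classical_set_scope.
Set Implicit Arguments.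
Unset Strict Implicit.
Context {R : realType}.
Implicit Types (a s x : R).
Notation mu := (@lebesgue_measure R).

(** The exponent is a parameter so that a factor [x] can be absorbed by a shift of [s]. *)
Definition gamma_kernel s x : R := x `^ s * expR (- x).

Lemma gamma_kernel_ge0 s x : 0 <= gamma_kernel s x.
Proof. by rewrite mulr_ge0 ?powR_ge0 ?expR_ge0. Qed.

Lemma gamma_kernelS s x : 0 < s -> 0 <= x ->
  gamma_kernel (s + 1) x = x * gamma_kernel s x.
Proof.
move=> s0 x0; rewrite /gamma_kernel powRD; last by rewrite gt_eqF ?addr_gt0.
by rewrite powRr1// mulrA (mulrC x).
Qed.

(** Raising [x <= 2s e^(x/(2s))], a consequence of [1 + y <= e^y], to the power [s] bounds [x^s] by
    [(2s)^s e^(x/2)]; half of the exponential decay survives. *)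
Lemma gamma_kernel_le s x : 0 < s -> 0 <= x ->
  gamma_kernel s x <= (2 * s) `^ s * expR (- (x / 2)).
Proof.
move=> s0 x0; have s2 : 0 < 2 * s by rewrite mulr_gt0.
have xle : x <= (2 * s) * expR (x / (2 * s)).
  rewrite -ler_pdivrMl// mulrC; apply: le_trans (expR_ge1Dx _).
  by rewrite lerDr.
have := ge0_ler_powR (ltW s0) _ _ xle; rewrite !nnegrE => /(_ x0).
rewrite mulr_ge0 ?(ltW s2) ?expR_ge0// => /(_ isT).
rewrite powRM ?(ltW s2) ?expR_ge0// -expRM => H.
apply: le_trans (ler_wpM2r (expR_ge0 (- x)) H) _.
rewrite -[leLHS]mulrA -expRD le_eqVlt; apply/orP; left; apply/eqP; congr (_ * expR _).
by field; rewrite gt_eqF.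
Qed.

Lemma cvgy_expRN_half : expR (- (x / 2)) @[x --> +oo%R] --> (0 : R).
Proof.
have := @cvgr_expR R.
apply: (@cvg_comp _ _ _ (fun x : R => x / 2) (fun x => expR (- x))).
apply: gt0_cvgMly => //.
Qed.

Lemma gamma_kernel_cvgy s : 0 < s -> gamma_kernel s x @[x --> +oo%R] --> 0.
Proof.
move=> s0.
apply: (@squeeze_cvgr _ _ _ _ (cst 0) (fun x => (2 * s) `^ s * expR (- (x / 2)))).
- by near=> x; rewrite gamma_kernel_ge0 gamma_kernel_le.
- exact: cvg_cst.
- rewrite -[X in _ --> X](mulr0 ((2 * s) `^ s)); apply: cvgM; first exact: cvg_cst.
  exact: cvgy_expRN_half.
Unshelve. all: by end_near. Qed.

Lemma is_derive_gamma_kernel s x : 0 < s -> 0 < x ->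
  is_derive x 1 (gamma_kernel (s + 1))
    ((s + 1) * gamma_kernel s x - gamma_kernel (s + 1) x).
Proof.
move=> s0 x0.
have D1 : is_derive x 1 (fun y : R => y `^ (s + 1)) ((s + 1) * x `^ s).
  by have := is_derive1_powR (s + 1) x0; rewrite addrK.
have D2 : is_derive x 1 (fun y : R => expR (- y)) (- expR (- x)).
  apply: is_derive_eq; rewrite /GRing.scale/=; ring.
apply: is_derive_eq; rewrite /gamma_kernel /GRing.scale/=; ring.
Qed.

Lemma continuous_gamma_kernel s : 0 < s ->
  {within `[0, +oo[, continuous (gamma_kernel s)}.
Proof.
move=> s0; apply/continuous_within_itvcyP; split.
  move=> x; rewrite in_itv/= andbT => x0.
  apply: cvgM; last first.
    apply: continuous_comp; [exact: continuousN|exact: continuous_expR].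
  suff : {for x, continuous (fun y : R => y `^ s)} by [].
  apply: differentiable_continuous; apply/derivable1_diffP.
  by have [] := is_derive1_powR s x0.
(* At the endpoint [0] only the right limit matters, and [s > 0] makes both it and the value
   zero. *)
rewrite {2}/gamma_kernel powR0 ?gt_eqF// mul0r.
rewrite -[X in _ --> X](mul0r (expR (- 0 : R))); apply: cvgM.
  exact: powR_cvg0.
apply: cvg_at_right_filter.
apply: continuous_comp; [exact: continuousN|exact: continuous_expR].
Qed.

(** * Calculus on [[a, +oo[] for functions dominated by [e^(-x/2)] *)

Lemma is_derive_expRN_half x :
  is_derive x 1 (fun y : R => expR (- (y / 2))) (- (expR (- (x / 2)) / 2)).
Proof. by apply: is_derive_eq; rewrite /GRing.scale/=; field. Qed.

Lemma continuous_expRN_half : continuous (fun x : R => expR (- (x / 2))).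
Proof.
move=> x; apply: differentiable_continuous; apply/derivable1_diffP.
by have [] := is_derive_expRN_half x.
Qed.

Lemma ge0_continuous_is_derive_FTC2y (f F : R -> R) a (l : R) :
  (forall x, a <= x -> 0 <= f x) -> {within `[a, +oo[, continuous f} ->
  F x @[x --> +oo%R] --> l -> F x @[x --> a^'+] --> F a ->
  (forall x, a < x -> is_derive x 1 F (f x)) ->
  (\int[mu]_(x in `[a, +oo[) (f x)%:E = (l - F a)%:E)%E.
Proof.
move=> f0 cf Fl Fa dF; rewrite (ge0_continuous_FTC2y f0 cf Fl _ Fa)//.
  by move=> x /dF[].
move=> x; rewrite in_itv/= andbT => /dF dFx.
by rewrite derive1E derive_val.
Qed.

Lemma measurable_within_itvcy (f : R -> R) a :
  {within `[a, +oo[, continuous f} -> measurable_fun `[a, +oo[ f.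
Proof. by apply: subspace_continuous_measurable_fun. Qed.

Lemma integral_expRN_half a C : 0 <= C ->
  (\int[mu]_(x in `[a, +oo[) (C * expR (- (x / 2)))%:E =
    (2 * C * expR (- (a / 2)))%:E)%E.
Proof.
move=> C0.
(* The value is rewritten as limit minus boundary value of the antiderivative [-2C e^(-x/2)]. *)
rewrite [RHS](_ : _ = (0 - - (2 * C) * expR (- (a / 2)))%:E); last first.
  by congr EFin; ring.
apply: (@ge0_continuous_is_derive_FTC2y _
   (fun x : R => - (2 * C) * expR (- (x / 2)))).
- by move=> x _; rewrite mulr_ge0 ?expR_ge0.
- apply: continuous_subspaceT => x.
  by apply: cvgM; [exact: cvg_cst|exact: continuous_expRN_half].
- rewrite -[X in _ --> X](mulr0 (- (2 * C))).
  by apply: cvgM; [exact: cvg_cst|exact: cvgy_expRN_half].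
- apply: cvg_at_right_filter.
  by apply: cvgM; [exact: cvg_cst|exact: continuous_expRN_half].
- move=> x _; have D := is_derive_expRN_half x.
  by apply: is_derive_eq; rewrite /GRing.scale/=; field.
Qed.

Lemma integrable_expRN_half a C : 0 <= C ->
  mu.-integrable `[a, +oo[ (fun x => (C * expR (- (x / 2)))%:E).
Proof.
move=> C0; apply/integrableP; split.
  apply/measurable_EFinP; apply: measurable_within_itvcy.
  apply: continuous_subspaceT => x.
  by apply: cvgM; [exact: cvg_cst|exact: continuous_expRN_half].
under eq_integral do rewrite gee0_abs ?lee_fin ?mulr_ge0 ?expR_ge0//.
by rewrite integral_expRN_half// ltry.
Qed.

Lemma exp_dominated_integrable (f : R -> R) a C :
  {within `[a, +oo[, continuous f} ->
  (forall x, a <= x -> `|f x| <= C * expR (- (x / 2))) ->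
  mu.-integrable `[a, +oo[ (EFin \o f).
Proof.
move=> cf fC.
(* The bound at [x = a] already forces the constant to be nonnegative. *)
have C0 : 0 <= C.
  by have := le_trans (normr_ge0 _) (fC a (lexx a)); rewrite pmulr_lge0 ?expR_gt0.
apply: le_integrable (integrable_expRN_half a C0) => //.
  by apply/measurable_EFinP; exact: measurable_within_itvcy.
move=> x; rewrite /= in_itv/= andbT => ax.
by rewrite lee_fin (le_trans (fC x ax))// ler_norm.
Qed.

(* Adding the dominating exponential to [f] makes it nonnegative, which is
   what the library's fundamental theorem of calculus on [a, +oo[ asks for. *)
Lemma exp_dominated_FTC2y (f F : R -> R) a (l C : R) :
  {within `[a, +oo[, continuous f} ->
  (forall x, a <= x -> `|f x| <= C * expR (- (x / 2))) ->
  F x @[x --> +oo%R] --> l -> F x @[x --> a^'+] --> F a ->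
  (forall x, a < x -> is_derive x 1 F (f x)) ->
  \int[mu]_(x in `[a, +oo[) f x = l - F a.
Proof.
move=> cf fC Fl Fa dF.
have C0 : 0 <= C.
  by have := le_trans (normr_ge0 _) (fC a (lexx a)); rewrite pmulr_lge0 ?expR_gt0.
have cg : {within `[a, +oo[, continuous (fun x : R => C * expR (- (x / 2)))}.
  apply: continuous_subspaceT => x.
  by apply: cvgM; [exact: cvg_cst|exact: continuous_expRN_half].
have E : (\int[mu]_(x in `[a, +oo[) (f x + C * expR (- (x / 2)))%:E =
    (l + - (2 * C) * 0 - (F a + - (2 * C) * expR (- (a / 2))))%:E)%E.
  apply: (@ge0_continuous_is_derive_FTC2y _
    (fun x : R => F x + - (2 * C) * expR (- (x / 2)))).
  - move=> x /fC; rewrite ler_norml => /andP[+ _].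
    by rewrite -subr_ge0 opprK addrC.
  - by move=> x; apply: cvgD; [exact: cf|exact: cg].
  - apply: cvgD => //.
    by apply: cvgM; [exact: cvg_cst|exact: cvgy_expRN_half].
  - apply: cvgD => //; apply: cvg_at_right_filter.
    by apply: cvgM; [exact: cvg_cst|exact: continuous_expRN_half].
  - move=> x /dF dFx; have D := is_derive_expRN_half x.
    by apply: is_derive_eq; rewrite /GRing.scale/=; field.
(* Domination makes [f] itself integrable, so the integral splits and the exponential part cancels
   on both sides. *)
have := @RintegralD _ _ R mu `[a, +oo[ f (fun x => C * expR (- (x / 2)))
  (measurable_itv _) (exp_dominated_integrable cf fC)
  (integrable_expRN_half a C0).
rewrite /Rintegral E integral_expRN_half//= => H.
by apply: (addIr (2 * C * expR (- (a / 2)))); rewrite -H; ring.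
Qed.

(** * Integrability and moments of polynomials against the kernel *)

Let itvcyS a : 0 <= a -> `[a, +oo[ `<=` `[0, +oo[.
Proof. by move=> a0 x; rewrite /= !in_itv/= !andbT; exact: le_trans. Qed.

Lemma integrable_gamma_kernel a s : 0 < s -> 0 <= a ->
  mu.-integrable `[a, +oo[ (EFin \o gamma_kernel s).
Proof.
move=> s0 a0; apply: (@exp_dominated_integrable _ _ ((2 * s) `^ s)).
  exact: continuous_subspaceW (itvcyS a0) (continuous_gamma_kernel s0).
by move=> x ax; rewrite ger0_norm ?gamma_kernel_ge0 ?gamma_kernel_le// (le_trans a0).
Qed.

(** The integrand is the derivative of [gamma_kernel (s + 1)], which vanishes at infinity. It
    changes sign at [x = s + 1], hence the dominated form of the fundamental theorem. *)
Lemma integral_gamma_kernelS a s : 0 < s -> 0 <= a ->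
  \int[mu]_(x in `[a, +oo[) ((s + 1) * gamma_kernel s x - gamma_kernel (s + 1) x)
    = - gamma_kernel (s + 1) a.
Proof.
move=> s0 a0; have s10 : 0 < s + 1 by rewrite addr_gt0.
have cg r : 0 < r -> {within `[a, +oo[, continuous (gamma_kernel r)}.
  by move=> r0; exact: continuous_subspaceW (itvcyS a0) (continuous_gamma_kernel r0).
rewrite -[RHS]sub0r; apply: (@exp_dominated_FTC2y _ (gamma_kernel (s + 1)) _ _
  ((s + 1) * (2 * s) `^ s + (2 * (s + 1)) `^ (s + 1))).
- move=> x; apply: cvgB; last exact: cg.
  by apply: cvgM; [exact: cvg_cst|exact: cg].
- move=> x ax; have x0 := le_trans a0 ax.
  rewrite (le_trans (ler_normB _ _))// [leRHS]mulrDl normrM.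
  rewrite !ger0_norm ?gamma_kernel_ge0 ?(ltW s10)// lerD ?gamma_kernel_le//.
  by rewrite -mulrA ler_wpM2l ?(ltW s10)// gamma_kernel_le.
- exact: gamma_kernel_cvgy.
- by have /continuous_within_itvcyP[] := cg _ s10.
- by move=> x ax; apply: is_derive_gamma_kernel => //; exact: le_lt_trans ax.
Qed.

(** Horner induction with [s] generalized: in [p * 'X + c] the factor [x] moves into the kernel and
    raises [s] by one. *)
Lemma integrable_poly_gamma_kernel a s (p : {poly R}) : 0 < s -> 0 <= a ->
  mu.-integrable `[a, +oo[ (fun x => (p.[x] * gamma_kernel s x)%:E).
Proof.
move=> + a0; elim/poly_ind: p s => [|p c IH] s s0.
  rewrite [X in _.-integrable _ X](_ : _ = cst 0%E); first exact: integrable0.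
  by apply/funext => x; rewrite horner0 mul0r.
apply: (@eq_integrable _ _ R mu `[a, +oo[ (measurable_itv _)
    (fun x => (p.[x] * gamma_kernel (s + 1) x)%:E + c%:E * (gamma_kernel s x)%:E)%E).
  move=> x; rewrite inE/= in_itv/= andbT => ax.
  rewrite -EFinM -EFinD hornerD hornerMX hornerC gamma_kernelS ?(le_trans a0)//.
  by congr EFin; ring.
apply: integrableD => //; first by apply: IH; rewrite addr_gt0.
by apply: integrableZl => //; exact: integrable_gamma_kernel.
Qed.

Definition gamma_moment a s (p : {poly R}) :=
  \int[mu]_(x in `[a, +oo[) (p.[x] * gamma_kernel s x).

Lemma gamma_moment_linear a s (k : R) (p q : {poly R}) : 0 < s -> 0 <= a ->
  gamma_moment a s (k *: p + q) = k * gamma_moment a s p + gamma_moment a s q.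
Proof.
move=> s0 a0; have ip := integrable_poly_gamma_kernel _ s0 a0.
transitivity (\int[mu]_(x in `[a, +oo[)
    (k * (p.[x] * gamma_kernel s x) + q.[x] * gamma_kernel s x)).
  by apply: eq_Rintegral => x _; rewrite hornerD hornerZ; ring.
have ikp := @integrableZl _ _ R mu `[a, +oo[ (measurable_itv _) k _ (ip p).
by rewrite RintegralD ?RintegralZl//; first [exact: ip | exact: ikp].
Qed.

(* Since [x * gamma_kernel s x = gamma_kernel (s + 1) x], replacing [q] by
   [q * 'X] amounts to shifting [s], so only constants [q] need calculus. *)
Lemma gamma_moment_pearson a s (q : {poly R}) : 0 < s -> 0 <= a ->
  gamma_moment a s (((1 + s)%:P - 'X) * q + 'X * q^`()) =
    - (a * gamma_kernel s a * q.[a]).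
Proof.
move=> + a0; elim/poly_ind: q s => [|q c IH] s s0.
  rewrite deriv0 !mulr0 addr0 horner0 mulr0 oppr0 /gamma_moment.
  rewrite (@eq_Rintegral _ _ _ mu _ (cst 0)) ?Rintegral_cst ?mul0r// => x _.
  by rewrite horner0 mul0r.
have s10 : 0 < s + 1 by rewrite addr_gt0.
(* Differentiating [q * 'X] yields an extra [q], which turns [1 + s] into [1 + (s + 1)]; the
   constant [c] contributes an exact derivative. *)
transitivity (\int[mu]_(x in `[a, +oo[)
   ((((1 + (s + 1))%:P - 'X) * q + 'X * q^`()).[x] * gamma_kernel (s + 1) x +
   c * ((s + 1) * gamma_kernel s x - gamma_kernel (s + 1) x))).
  apply: eq_Rintegral => x; rewrite inE/= in_itv/= andbT => ax.
  by rewrite gamma_kernelS ?(le_trans a0)// derivMXaddC !hornerE/=; ring.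
have ik : mu.-integrable `[a, +oo[
    (fun x => ((s + 1) * gamma_kernel s x - gamma_kernel (s + 1) x)%:E).
  have := integrable_poly_gamma_kernel ((s + 1)%:P - 'X) s0 a0.
  apply: eq_integrable => // x; rewrite inE/= in_itv/= andbT => ax.
  rewrite gamma_kernelS ?(le_trans a0)// hornerD hornerN hornerX hornerC.
  by congr EFin; ring.
have ick := @integrableZl _ _ R mu `[a, +oo[ (measurable_itv _) c _ ik.
have iq := integrable_poly_gamma_kernel
  (((1 + (s + 1))%:P - 'X) * q + 'X * q^`()) s10 a0.
rewrite RintegralD//; do ?[exact: iq|exact: ick].
rewrite RintegralZl//; do ?[exact: ik].
rewrite integral_gamma_kernelS// -/(gamma_moment _ _ _) IH//.
by rewrite gamma_kernelS// hornerD hornerMX hornerC; ring.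
Qed.

Lemma negligible_roots (p : {poly R}) : p != 0 -> mu.-negligible [set x | root p x].
Proof.
(* An infinite root set would contain [size p] distinct roots, more than a nonzero [p] can have. *)
move=> p0; have fr : finite_set [set x | root p x].
  apply: contrapT => /(infinite_set_fset (size p))[B Bp].
  rewrite leqNgt => /negP; apply; apply: max_poly_roots => //.
    by apply/allP => x xB; exact: Bp.
  exact: finmap.fset_uniq.
apply/negligibleP.
  by apply: countable_measurable => //; exact: finite_set_countable.
by apply: countable_lebesgue_measure0; exact: finite_set_countable.
Qed.

(** * The weight with a jump at [t] *)

Section weight.
Variables alpha A B t : R.
Hypotheses (alpha0 : 0 < alpha) (t0 : 0 < t).
Local Notation w := (weight alpha A B t).

Lemma weightE (p : {poly R}) x : p.[x] * w x =
  A * (p.[x] * gamma_kernel alpha x) +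
  B * ((fun y => p.[y] * gamma_kernel alpha y) \_ `]t, +oo[) x.
Proof.
rewrite /weight /heaviside patchE mem_setE in_itv/= andbT subr_gt0 /gamma_kernel.
by case: ifP => _; rewrite /point/=; ring.
Qed.

Let itv_int : `[0, +oo[ `&` `]t, +oo[ = `]t, +oo[.
Proof.
apply/setIidr => x; rewrite /= !in_itv/= !andbT => /ltW; apply: le_trans.
exact: ltW.
Qed.

Let integrable_tail (p : {poly R}) : mu.-integrable `[0, +oo[
  (EFin \o ((fun y => p.[y] * gamma_kernel alpha y) \_ `]t, +oo[)).
Proof.
rewrite -restrict_EFin; apply/integrable_restrict => //.
rewrite itv_int.
apply: integrableS (integrable_poly_gamma_kernel p alpha0 (ltW t0)) => //.
by move=> x; rewrite /= !in_itv/= !andbT; exact: ltW.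
Qed.

Lemma integrable_poly_weight (p : {poly R}) :
  mu.-integrable `[0, +oo[ (fun x => (p.[x] * w x)%:E).
Proof.
have i0 := integrable_poly_gamma_kernel p alpha0 (lexx 0).
have ia := @integrableZl _ _ R mu `[0, +oo[ (measurable_itv _) A _ i0.
have ib := @integrableZl _ _ R mu `[0, +oo[ (measurable_itv _) B _ (integrable_tail p).
have := @integrableD _ _ R mu `[0, +oo[ (measurable_itv _) _ _ ia ib.
apply: eq_integrable => // x _.
by rewrite weightE EFinD !EFinM.
Qed.

Definition weight_moment (p : {poly R}) :=
  \int[mu]_(x in `[0, +oo[) (p.[x] * w x).

(** The Heaviside factor restricts the [B] part to the tail beyond [t], so facts about
    [gamma_moment] at [0] and at [t] transfer to the weight. *)
Lemma weight_momentE (p : {poly R}) : weight_moment p =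
  A * gamma_moment 0 alpha p + B * gamma_moment t alpha p.
Proof.
rewrite /weight_moment; under eq_Rintegral do rewrite weightE.
have i0 := integrable_poly_gamma_kernel p alpha0 (lexx 0).
have it := integrable_poly_gamma_kernel p alpha0 (ltW t0).
have ia := @integrableZl _ _ R mu `[0, +oo[ (measurable_itv _) A _ i0.
have ib := @integrableZl _ _ R mu `[0, +oo[ (measurable_itv _) B _ (integrable_tail p).
rewrite RintegralD//; do ?[exact: ia|exact: ib].
rewrite RintegralZl//; do ?[exact: i0].
rewrite RintegralZl//; do ?[exact: integrable_tail].
(* The Heaviside function is [0] at the jump, which gives an open tail; the single point [t] has
   measure zero. *)
rewrite -Rintegral_mkcondr itv_int Rintegral_itv_obnd_cbnd//.
apply: integrableS it => //.
by move=> x; rewrite /= !in_itv/= !andbT; exact: ltW.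
Qed.

Lemma weight_moment_linear k (p q : {poly R}) :
  weight_moment (k *: p + q) = k * weight_moment p + weight_moment q.
Proof.
have lin a := @gamma_moment_linear a _ k p q alpha0.
by rewrite !weight_momentE (lin _ (lexx 0)) (lin _ (ltW t0)); ring.
Qed.

(** The boundary term at [0] carries the factor [a = 0], so only the jump at [t] contributes. *)
Lemma weight_moment_pearson (q : {poly R}) :
  weight_moment (((1 + alpha)%:P - 'X) * q + 'X * q^`()) =
    - (t * (B * t `^ alpha * expR (- t)) * q.[t]).
Proof.
rewrite weight_momentE (gamma_moment_pearson q alpha0 (lexx 0)).
by rewrite (gamma_moment_pearson q alpha0 (ltW t0)) /gamma_kernel; ring.
Qed.

(** A zero integral would make [p ^+ 2] times the weight vanish almost everywhere. Beyond [t] the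
    weight is positive since [B > 0], so that whole half-line would be negligible together with the
    roots of [p], yet its measure is infinite. *)
Lemma weight_moment_sqr_neq0 (p : {poly R}) : 0 <= A -> 0 < B -> p != 0 ->
  weight_moment (p ^+ 2) != 0.
Proof.
move=> A0 B0 p0; apply/eqP => h0.
have ip := integrable_poly_weight (p ^+ 2).
have int0 : (\int[mu]_(x in `[0%R, +oo[) `|((p ^+ 2).[x] * w x)%:E| = 0)%E.
  transitivity ((weight_moment (p ^+ 2))%:E); last by rewrite h0.
  rewrite /weight_moment /Rintegral fineK; last exact: integrable_fin_num ip.
  apply: eq_integral => x _; rewrite gee0_abs// lee_fin horner_exp.
  have hx0 : 0 <= heaviside (x - t) by rewrite /heaviside; case: ifP.
  rewrite mulr_ge0 ?sqr_ge0// /weight mulr_ge0//.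
    by rewrite mulr_ge0 ?powR_ge0 ?expR_ge0.
  by rewrite addr_ge0// mulr_ge0// ltW.
have [/(_ int0) ae0 _] := @ae_eq_integral_abs _ _ R mu `[0, +oo[
  (measurable_itv _) _ (measurable_int _ ip).
have : mu.-negligible `]t, +oo[.
  apply: negligibleS (negligibleU ae0 (negligible_roots p0)) => x /=.
  rewrite in_itv/= andbT => tx.
  have [px|px] := boolP (root p x); [by right|left => /=].
  have x0 : 0 < x by exact: lt_trans tx.
  have wx : 0 < w x.
    rewrite /weight /heaviside subr_gt0 tx mulr1.
    by rewrite !mulr_gt0 ?powR_gt0 ?expR_gt0 ?ltr_wpDl.
  rewrite in_itv/= andbT => /(_ (ltW x0)) [] /eqP.
  by rewrite mulf_eq0 horner_exp sqrf_eq0 (gt_eqF wx) orbF; exact/negP.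
move=> /measure_negligible -/(_ (measurable_itv _)).
by rewrite [LHS](lebesgue_measure_itv `]t, +oo[%R)/= ltry.
Qed.
End weight.

End Analysis.

Theorem theorem2 (R : realType) (alpha A B t : R) (P : nat -> {poly R}) (n : nat) :
  0 < alpha -> 0 <= A -> 0 < B -> 0 < t ->
  monic_orthogonal alpha A B t P ->
  (1 <= n)%N ->
  t * \sum_(j < n) Rn alpha A B t P j
    = - t * rn alpha A B t P n - n%:R * (n%:R + alpha) + beta_coef alpha A B t P n
  /\ \sum_(j < n) alpha_coef alpha A B t P j = - p1 P n
  /\ - p1 P n = beta_coef alpha A B t P n - t * rn alpha A B t P n.
Proof.
move=> alpha0 A0 B0 t0 [P_monic [size_P P_orth]] n1.
(* The moment map is packed as a linear form, to which the algebraic lemmas on [L] apply. *)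
pose M : {poly R} -> R^o := weight_moment alpha A B t.
have Mlin : linear M by move=> k p q; exact: weight_moment_linear.
pose L := HB.pack_for {scalar {poly R}} M
  (GRing.isLinear.Build R {poly R} R^o *:%R M Mlin).
have LE p : L p = weight_moment alpha A B t p by [].
have L_orth i j : i <> j -> L (P i * P j) = 0.
  move=> /P_orth ij; rewrite LE /weight_moment /Rintegral.
  by under eq_integral do rewrite hornerM; rewrite ij.
have hE i : hnorm alpha A B t P i = L (P i ^+ 2).
  by rewrite LE; apply: eq_Rintegral => x _; rewrite horner_exp.
have h0 i : L (P i ^+ 2) != 0.
  by apply: weight_moment_sqr_neq0 => //; exact: monic_neq0.
have pearson := weight_moment_pearson A B alpha0 t0.
have alphaE i : alpha_coef alpha A B t P i = p1 P i - p1 P i.+1.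
  rewrite /alpha_coef hE; apply: (canLR (mulfK (h0 i))).
  rewrite -(moment_X L P P_monic size_P L_orth) LE.
  by apply: eq_Rintegral => x _; rewrite hornerM hornerX horner_exp.
have sum_alpha m : \sum_(j < m) alpha_coef alpha A B t P j = - p1 P m.
  elim: m => [|m IH]; first by rewrite big_ord0 oppr0.
  by rewrite big_ord_recr/= IH alphaE addrA addNr sub0r.
have RnE i : t * Rn alpha A B t P i =
    alpha_coef alpha A B t P i - (1 + alpha + i%:R *+ 2).
  rewrite alphaE /Rn hE mulrA; apply: (canLR (mulfK (h0 i))).
  rewrite mulrBl (pearson_diag L P alpha _ t P_monic size_P L_orth pearson).
  by rewrite [RHS]addrC addKr !mulrA.
(* The terms [1 + alpha + 2j] for [j < m] add up to [m (m + alpha)]. *)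
have sum_Rn m : t * \sum_(j < m) Rn alpha A B t P j =
    - p1 P m - m%:R * (m%:R + alpha).
  rewrite -sum_alpha; elim: m => [|m IH]; first by rewrite !big_ord0; ring.
  by rewrite !big_ord_recr/= mulrDr IH RnE -natr1; ring.
have p1E : - p1 P n = beta_coef alpha A B t P n - t * rn alpha A B t P n.
  (* Writing [n] as [m.+1] makes the predecessor in [beta_coef] and [rn] a genuine index. *)
  case: n n1 => // m _; rewrite /beta_coef /rn !hE /= mulrA -mulrBl.
  apply: (canRL (mulfK (h0 m))).
  rewrite (pearson_offdiag L P alpha _ t P_monic size_P L_orth pearson).
  by rewrite !mulrA.
split; last by split; [exact: sum_alpha|].
by rewrite sum_Rn p1E; ring.
Qed.
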